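(* Let $G$ be a (finite or infinite) distributive group and let $a,b\in G$. Then there exists a bijective map $\varphi:G\to G$ with $\varphi(x.y)=\varphi(x).\varphi(y)$ for all $x,y\in G$ (an isomorphism of $G$ onto itself) such that $\varphi(a)=b$.
   Context: A distributive group is a nonempty set $G$ with a binary operation $(a,b)\mapsto a.b$ on $G$ such that (II) for all $a,b\in G$ each of the equations $a.x=b$ and $y.a=b$ has exactly one solution in $G$, and (III) for all $a,b,c\in G$, $(a.b).c=(a.c).(b.c)$ and $c.(a.b)=(c.a).(c.b)$. *)

(* Defs.v *)
From mathcomp Require Import all_boot.

Set Implicit Arguments.
Unset Strict Implicit.
Unset Printing Implicit Defensive.

Record distributive_group (G : Type) (op : G -> G -> G) : Prop :=
  DistributiveGroup {
    dg_nonempty : inhabited G;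
    dg_ldiv : forall a b : G, exists! x, op a x = b;
    dg_rdiv : forall a b : G, exists! y, op y a = b;
    dg_distl : left_distributive op op;
    dg_distr : right_distributive op op
  }.

(* Main.v *)
Require Import Defs.
From mathcomp Require Import all_boot.
From Stdlib Require Import IndefiniteDescription.

(** Every right translation [fun x => op x c] is an automorphism: it is
    multiplicative because [op] distributes over itself from the right, and
    bijective because each equation [op y c = d] has exactly one solution.
    Solvability of [op a c = b] in [c] provides a translation taking [a] to
    [b]. *)

(** [bijective] asks for an inverse function, so the pointwise unique preimages
    are assembled into one by a choice axiom. *)
Lemma bijective_of_unique_preimage (A B : Type) (f : A -> B) :
  (forall y, exists! x, f x = y) -> bijective f.
Proof.
move=> f_uniq.
have f_surj y : exists x, f x = y by case: (f_uniq y) => x [fx _]; exists x.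
pose g y := proj1_sig (constructive_indefinite_description _ (f_surj y)).
have gK : cancel g f.
  by move=> y; exact: proj2_sig (constructive_indefinite_description _ (f_surj y)).
exists g => // x.
have [z [_ z_uniq]] := f_uniq (f x).
by rewrite -(z_uniq (g (f x)) (gK (f x))); exact: z_uniq.
Qed.

Theorem mainTheorem1 (G : Type) (op : G -> G -> G)
    (hG : distributive_group op) (a b : G) :
  exists phi : G -> G,
    [/\ bijective phi, {morph phi : x y / op x y} & phi a = b].
Proof.
have [c [ac_b _]] := dg_ldiv hG a b.
exists (op^~ c); split=> //.
- exact/bijective_of_unique_preimage/(dg_rdiv hG).
- by move=> x y; exact: (dg_distl hG).
Qed.
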